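(* Consider the following problem: given a finite set $S$ with $n=|S|$ elements containing a designated element $0\in S$, and binary operations $\oplus,\odot:S\times S\to S$ given by Cayley tables, decide whether $\big((a\odot b)\oplus(a\odot c)\big)\oplus(b\odot c)=0$ holds for all $a,b,c\in S$. If for some constant $\epsilon>0$ this problem can be solved in time $O(n^{3-\epsilon})$, then the Strong Zero Triangle Hypothesis fails.
   Context: Strong Zero Triangle Hypothesis: for no constant $\epsilon>0$ is there an algorithm that, given an $n$-vertex graph with integer edge weights in $\{-n,\dots,n\}$, decides in time $O(n^{3-\epsilon})$ whether it contains a triangle whose three edge weights sum to $0$. Computation is in the word-RAM model with $O(\log n)$-bit words. *)

(* Defs.v *)
From mathcomp Require Import all_boot all_order all_algebra.
From mathcomp Require Import all_classical all_reals all_analysis.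

Set Implicit Arguments.
Unset Strict Implicit.
Unset Printing Implicit Defensive.

Import Order.TTheory GRing.Theory Num.Theory.
Import numFieldNormedType.Exports.

Local Open Scope classical_set_scope.

(* A deterministic word RAM. A word of [w] bits is a natural number below     *)
(* [2 ^ w]. A machine has registers and a memory, all holding words; since    *)
(* addresses are words, only [2 ^ w] memory cells are reachable. A program is *)
(* a finite list of instructions that does not depend on [w], and every       *)
(* instruction costs one time unit.                                           *)

Inductive binop :=
  | Add | Sub | Mul | Div | Mod | And | Or | Xor | Shl | Shr.

Inductive cmp := Eq | Lt.

Inductive instr :=
  | Const of nat & nat                 (* Const r k       : r := k            *)
  | Arith of binop & nat & nat & nat   (* Arith o r s t   : r := s o t        *)
  | Read of nat & nat                  (* Read r s        : r := mem[s]       *)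
  | Write of nat & nat                 (* Write r s       : mem[r] := s       *)
  | Branch of cmp & nat & nat & nat    (* Branch c r s l  : if r c s goto l   *)
  | Halt of bool.                      (* accept or reject                    *)

Definition program := seq instr.

Record state := State {
  pc : nat;
  regs : nat -> nat;
  mem : nat -> nat }.

Definition upd (f : nat -> nat) (a v : nat) : nat -> nat :=
  fun b => if b == a then v else f b.

(* Arithmetic is modulo [2 ^ w]. Division by zero follows ssrnat's            *)
(* conventions: [x %/ 0 = 0] and [x %% 0 = x].                                *)
Definition sem_binop (w : nat) (o : binop) (x y : nat) : nat :=
  (match o with
   | Add => x + y
   | Sub => x + (2 ^ w - y)
   | Mul => x * y
   | Div => x %/ y
   | Mod => x %% y
   | And => Nat.land x y
   | Or => Nat.lor x y
   | Xor => Nat.lxor x y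
   | Shl => x * 2 ^ y
   | Shr => x %/ 2 ^ y
   end) %% 2 ^ w.

Definition sem_cmp (c : cmp) (x y : nat) : bool :=
  match c with Eq => x == y | Lt => x < y end.

Definition step (w : nat) (i : instr) (s : state) : state + bool :=
  let: State p r m := s in
  match i with
  | Const a k => inl (State p.+1 (upd r a (k %% 2 ^ w)) m)
  | Arith o a b c => inl (State p.+1 (upd r a (sem_binop w o (r b) (r c))) m)
  | Read a b => inl (State p.+1 (upd r a (m (r b))) m)
  | Write a b => inl (State p.+1 r (upd m (r a) (r b)))
  | Branch c a b l => inl (State (if sem_cmp c (r a) (r b) then l else p.+1) r m)
  | Halt b => inr b
  end.

(* [run w P t s = Some b] iff [P], started in [s], halts with answer [b]      *)
(* within [t] steps; a program counter outside [P] never yields an answer.    *)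
Fixpoint run (w : nat) (P : program) (t : nat) (s : state) : option bool :=
  if t is t'.+1 then
    if onth P (pc s) is Some i then
      match step w i s with
      | inl s' => run w P t' s'
      | inr b => Some b
      end
    else None
  else None.

(* The input occupies the memory cells 0, 1, 2, ..., truncated to words: the  *)
(* word length has to be large enough for the input to be readable.           *)
Definition init_state (w : nat) (input : seq nat) : state :=
  State 0 (fun=> 0) (fun a => nth 0 input a %% 2 ^ w).

Record problem := Problem {
  instance : Type;
  size_of : instance -> nat;
  encode : instance -> seq nat;
  yes : instance -> Prop }.

(* [(trunc_log 2 n).+1] is the bit length of [n > 0]. *)
Definition word_length (c n : nat) : nat := c * (trunc_log 2 n).+1.

Definition decides (P : program) (c : nat) (T : nat -> nat) (pb : problem) :
    Prop :=
  forall x : instance pb, exists b : bool,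
    run (word_length c (size_of x)) P (T (size_of x))
        (init_state (word_length c (size_of x)) (encode x)) = Some b
    /\ (b <-> yes x).

(* Solvable in time O(f(n)) with O(log n)-bit words: the algorithm consists   *)
(* of the program together with the constant [c] in the word length.          *)
Definition solvable_in_time (R : realType) (pb : problem) (f : nat -> R) :
    Prop :=
  exists (P : program) (c : nat) (T : nat -> nat),
    decides P c T pb /\ ((fun n => (T n)%:R : R) =O_\oo f)%R.

(* Integer edge-weighted graphs; [wt i j] is meaningful only on edges. *)
Record wgraph := WGraph {
  nv : nat;
  adj : rel 'I_nv;
  wt : 'I_nv -> 'I_nv -> int;
  adj_sym : symmetric adj;
  adj_irr : irreflexive adj;
  wt_sym : forall i j, adj i j -> wt i j = wt j i;
  wt_bound : forall i j, adj i j -> (- nv%:Z <= wt i j <= nv%:Z)%R }.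

Definition has_zero_triangle (G : wgraph) : Prop :=
  exists i j k : 'I_(nv G),
    [/\ adj i j, adj i k, adj j k & (wt i j + wt i k + wt j k)%R = 0%R].

(* Row-major adjacency matrix: 0 for a non-edge, and [1 + (n + weight)] in    *)
(* [1, 2n + 1] for an edge.                                                   *)
Definition encode_wgraph (G : wgraph) : seq nat :=
  nv G ::
  [seq (if adj i j then `|(wt i j + (nv G)%:Z)%R|%N.+1 else 0)
     | i <- enum 'I_(nv G), j <- enum 'I_(nv G)].

Definition zero_triangle : problem :=
  Problem nv encode_wgraph has_zero_triangle.

Definition strong_zero_triangle_hypothesis (R : realType) : Prop :=
  forall eps : R, (0 < eps)%R ->
    ~ solvable_in_time zero_triangle (fun n => n%:R `^ (3 - eps))%R.

(* A finite set with two binary operations, its elements being named          *)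
(* 0, ..., n - 1; the designated element [zero] is any of them.               *)
Record cayley := Cayley {
  card : nat;
  zero : 'I_card;
  oplus : 'I_card -> 'I_card -> 'I_card;
  odot : 'I_card -> 'I_card -> 'I_card }.

Definition cayley_identity (S : cayley) : Prop :=
  forall a b c : 'I_(card S),
    oplus (oplus (odot a b) (odot a c)) (odot b c) = zero S.

Definition table (n : nat) (f : 'I_n -> 'I_n -> 'I_n) : seq nat :=
  [seq val (f i j) | i <- enum 'I_n, j <- enum 'I_n].

Definition encode_cayley (S : cayley) : seq nat :=
  card S :: val (zero S) :: table (@oplus S) ++ table (@odot S).

Definition identity_checking : problem :=
  Problem card encode_cayley cayley_identity.

(* Main.v *)
Require Import Defs.
From mathcomp Require Import all_boot all_order all_algebra.
From mathcomp Require Import all_classical all_reals all_analysis.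
From mathcomp Require Import zify lra.
Import numFieldNormedType.Exports.

Set Implicit Arguments.
Unset Strict Implicit.
Unset Printing Implicit Defensive.

(* Write the weight v of an edge of an n-vertex graph as the code 1 + n + v   *)
(* in [1, 2n + 1] and a non-edge as 0, and let S = {0, ..., 6n + 5}. For a    *)
(* and b in S, the product of a and b is the code of the pair of vertices     *)
(* (a mod n, b mod n). The sum x + y with x <= 2n + 1 is shifted by 2n + 2,   *)
(* hence leaves the range of codes, so that a second sum is recognizable: it  *)
(* is nonzero only if the three codes add up to 3n + 3, i.e., if the three    *)
(* weights add up to 0. As 0 is absorbing, the identity holds in S iff the    *)
(* graph has no zero triangle.                                                *)
(* The tables of S are written in time O(n^2), after which the algorithm for  *)
(* the identity is run. That algorithm computes modulo 2 ^ w for its own word *)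
(* length w, whereas the graph algorithm has longer words: each result is     *)
(* reduced modulo 2 ^ w, and the simulated memory starts after the input.     *)

(** A fast identity checker is compiled into a zero-triangle algorithm. The structure [cayley_of G]
    satisfies the identity exactly when [G] has no zero triangle ([cayley_ofP]), so the answer is
    negated. It has [6 * n.+1] elements, so a saving over cubic time survives the linear blow-up.
    The tables cost O(n^2) steps ([setup_correct]), the simulation costs a factor of two
    ([simulation]), and [word_length_reduction] shows that O(log n) bits suffice. Capping the saving
    at 1 keeps the time bound at least quadratic, so that it absorbs the table construction
    ([time_reduction]). *)

Definition reaches (w : nat) (P : program) (t : nat) (s : state)
    (Q : state -> Prop) : Prop :=
  exists t0 s', [/\ t0 <= t, Q s' &
    forall u, run w P (t0 + u) s = run w P u s'].

Lemma run_mono w P t t' s b :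
  run w P t s = Some b -> t <= t' -> run w P t' s = Some b.
Proof.
elim: t t' s => // t IH [|t'] s //= ; case: onth => // i.
by case: step => // s' /IH; apply.
Qed.

Lemma run_step w P t p r m i : onth P p = Some i ->
  run w P t.+1 (State p r m) =
  match step w i (State p r m) with
  | inl s' => run w P t s'
  | inr b => Some b
  end.
Proof. by rewrite /= => ->. Qed.

Lemma run_next w P t p r m i s' :
    onth P p = Some i -> step w i (State p r m) = inl s' ->
  run w P t.+1 (State p r m) = run w P t s'.
Proof. by move=> Pi; rewrite (run_step _ _ _ _ Pi) => ->. Qed.

Lemma reaches_now w P t s (Q : state -> Prop) : Q s -> reaches w P t s Q.
Proof. by move=> Qs; exists 0, s. Qed.

(** Times are only upper bounds, so that paths of different lengths through a block can be
    joined. *)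
Lemma reaches_leq w P t t' s Q :
  t <= t' -> reaches w P t s Q -> reaches w P t' s Q.
Proof.
move=> le_t [u [s' [le_u Qs' run_s]]]; exists u, s'.
by split; rewrite ?(leq_trans le_u).
Qed.

Lemma reaches_step w P t i p r m s' Q :
    onth P p = Some i -> step w i (State p r m) = inl s' ->
  reaches w P t s' Q -> reaches w P t.+1 (State p r m) Q.
Proof.
move=> Pi si [t0 [s1 [le_t0 Qs1 run_s1]]]; exists t0.+1, s1; split=> // u.
by move: si; rewrite addSn /= Pi => ->.
Qed.

(* Registers are represented by a list [env], padded by zeros, so that the    *)
(* updates done by a concrete piece of program are computed by [set_nth].     *)
Lemma upd_nth env a v : upd (nth 0 env) a v = nth 0 (set_nth 0 env a v).
Proof. by apply: funext => b; rewrite nth_set_nth. Qed.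

Section EnvSteps.
Context (w : nat) (P : program).
Implicit Types (env : seq nat) (m : nat -> nat) (Q : state -> Prop).

Lemma reaches_const t p a k env m Q :
    onth P p = Some (Const a k) -> k < 2 ^ w ->
    reaches w P t (State p.+1 (nth 0 (set_nth 0 env a k)) m) Q ->
  reaches w P t.+1 (State p (nth 0 env) m) Q.
Proof.
by move=> Pi kw; apply: (reaches_step Pi); rewrite /= modn_small// upd_nth.
Qed.

Lemma reaches_arith v t p o a b c env m Q :
    onth P p = Some (Arith o a b c) ->
    sem_binop w o (nth 0 env b) (nth 0 env c) = v ->
    reaches w P t (State p.+1 (nth 0 (set_nth 0 env a v)) m) Q ->
  reaches w P t.+1 (State p (nth 0 env) m) Q.
Proof.
by move=> Pi v_def; apply: (reaches_step Pi); rewrite /= v_def upd_nth.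
Qed.

Lemma reaches_read v t p a b env m Q :
    onth P p = Some (Read a b) -> m (nth 0 env b) = v ->
    reaches w P t (State p.+1 (nth 0 (set_nth 0 env a v)) m) Q ->
  reaches w P t.+1 (State p (nth 0 env) m) Q.
Proof.
by move=> Pi v_def; apply: (reaches_step Pi); rewrite /= v_def upd_nth.
Qed.

Lemma reaches_write t p a b env m Q :
    onth P p = Some (Write a b) ->
    reaches w P t
      (State p.+1 (nth 0 env) (upd m (nth 0 env a) (nth 0 env b))) Q ->
  reaches w P t.+1 (State p (nth 0 env) m) Q.
Proof. by move=> Pi; apply: (reaches_step Pi). Qed.

Lemma reaches_branch t p c a b l env m Q :
    onth P p = Some (Branch c a b l) ->
    reaches w P t
      (State (if sem_cmp c (nth 0 env a) (nth 0 env b) then l else p.+1)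
             (nth 0 env) m) Q ->
  reaches w P t.+1 (State p (nth 0 env) m) Q.
Proof. by move=> Pi; apply: (reaches_step Pi). Qed.

End EnvSteps.

(* The registers below 15 are not used by the simulated machine:              *)
(*   0, 1: the constants 0 and 1        2: n = nv G       3: N = 6 (n + 1)    *)
(*   4: n + 1     5: 2 ^ w, where w = c * l is the simulated word length      *)
(*   6: 2 (n + 1)     7: 5 (n + 1)      8: N * N, the base address            *)
(*   9: k, the index of the table entries x + y and x . y being written,      *)
(*      where x = k %/ N and y = k %% N (registers 10 and 11)                 *)
(* Before the tables are written, register 11 contains the bit length l of N  *)
(* and register 10 is 2 ^ l. The numbers in the margin are jump targets.      *)
Definition setup (c : nat) : program :=
  [:: Read 2 0;
      Const 1 1;
      Arith Add 4 2 1;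
      Const 12 6;
      Arith Mul 3 12 4;
      Const 12 2;
      Arith Mul 6 12 4;
      Const 12 5;
      Arith Mul 7 12 4;
      Arith Mul 8 3 3;
      Const 10 1;
(*11*)  Branch Lt 3 10 15;
      Arith Add 10 10 10;
      Arith Add 11 11 1;
      Branch Eq 0 0 11;
(*15*)  Const 12 c;
      Arith Mul 12 12 11;
      Arith Shl 5 1 12;
      Arith Mod 12 3 5;
      Write 8 12;
(*20*)  Arith Div 10 9 3;
      Arith Mod 11 9 3;
      Const 12 0;
      Branch Eq 10 0 30;
      Branch Eq 11 0 30;
      Arith Add 13 10 11;
      Branch Lt 10 6 29;
      Branch Eq 13 7 29;
      Branch Eq 0 0 30;
(*29*)  Arith Add 12 13 6;
(*30*)  Arith Mod 12 12 3;
      Arith Mod 12 12 5;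
      Const 14 2;
      Arith Add 13 14 9;
      Arith Add 13 8 13;
      Write 13 12;
      Arith Mod 12 10 2;
      Arith Mul 12 12 2;
      Arith Mod 10 11 2;
      Arith Add 12 12 10;
      Arith Add 12 12 1;
      Read 12 12;
      Arith Mod 12 12 3;
      Arith Mod 12 12 5;
      Arith Add 13 13 8;
      Write 13 12;
      Arith Add 9 9 1;
      Branch Lt 9 8 20 ].

(* Every instruction takes two places, hence the padding after a branch.      *)
Definition simulate_instr (i : instr) : program :=
  match i with
  | Const a k => [:: Const (15 + a) k; Arith Mod (15 + a) (15 + a) 5]
  | Arith o a b c =>
      [:: Arith o (15 + a) (15 + b) (15 + c); Arith Mod (15 + a) (15 + a) 5]
  | Read a b => [:: Arith Add 12 8 (15 + b); Read (15 + a) 12]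
  | Write a b => [:: Arith Add 12 8 (15 + a); Write 12 (15 + b)]
  | Branch c a b l =>
      [:: Branch c (15 + a) (15 + b) (48 + 2 * l); Const 12 0]
  | Halt b => [:: Halt (~~ b); Halt (~~ b)]
  end.

Definition reduction_program (c : nat) (P : program) : program :=
  setup c ++ flatten (map simulate_instr P).

(** * Simulating the identity checker with longer words *)

Lemma onth_reduction c P p i : onth P p = Some i ->
  onth (reduction_program c P) (48 + 2 * p) = onth (simulate_instr i) 0
  /\ onth (reduction_program c P) (48 + 2 * p).+1 = onth (simulate_instr i) 1.
Proof.
have skip q : onth (reduction_program c P) (48 + q)
   = onth (flatten (map simulate_instr P)) q by [].
rewrite -addnS !skip {skip}.
elim: P p => [|j P IH] [|p] //.
  by case=> ->; case: i {IH} => *; split.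
by rewrite mulnS add2n => /IH; case: j.
Qed.

(** The bounds by [2 ^ w] belong to the invariant: they keep each simulated address inside the
    represented block of memory. *)
Definition simulates (w base : nat) (s s' : state) : Prop :=
  [/\ pc s' = 48 + 2 * pc s,
      regs s' 5 = 2 ^ w, regs s' 8 = base,
      forall r, regs s' (15 + r) = regs s r /\ regs s r < 2 ^ w &
      forall a, a < 2 ^ w ->
        Defs.mem s' (base + a) = Defs.mem s a /\ Defs.mem s a < 2 ^ w].

(** Since [2 ^ w] divides [2 ^ w'], reducing twice is reducing once. Only [Sub] also mentions the
    word length in its operand; there [2 ^ w' - y] and [2 ^ w - y] are congruent. *)
Lemma sem_binop_mod w w' o x y : w < w' -> y < 2 ^ w ->
  sem_binop w' Mod (sem_binop w' o x y) (2 ^ w) = sem_binop w o x y.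
Proof.
move=> lt_w yw.
have dv : 2 ^ w %| 2 ^ w' by rewrite dvdn_exp2l// ltnW.
have lt2 : 2 ^ w < 2 ^ w' by rewrite ltn_exp2l.
rewrite {1}/sem_binop modn_small; last first.
  by rewrite (leq_trans _ (ltnW lt2))// ltn_mod expn_gt0.
rewrite /sem_binop modn_dvdm//; case: o => //.
have /dvdnP[q qE] := dvdn_sub dv (dvdnn (2 ^ w)).
have -> : 2 ^ w' = q * 2 ^ w + 2 ^ w by rewrite -qE subnK// ltnW.
by rewrite -addnBA 1?ltnW// addnCA modnMDl.
Qed.

Lemma simulation w w' base c P t s s' b :
    w < w' -> base + 2 ^ w <= 2 ^ w' -> simulates w base s s' ->
    run w P t s = Some b ->
  run w' (reduction_program c P) (2 * t) s' = Some (~~ b).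
Proof.
move=> lt_w le_base.
have lt2 : 2 ^ w < 2 ^ w' by rewrite ltn_exp2l.
have dv : 2 ^ w %| 2 ^ w' by rewrite dvdn_exp2l// ltnW.
elim: t s s' => // t IH [p r m] [p' r' m'].
rewrite mulnS add2n => -[]; rewrite [pc _]/= [pc _]/= => pE r5 r8 rr mm.
case Pi: (onth P p) => [i|]; last by rewrite /= Pi.
have [] := onth_reduction c Pi; rewrite -pE => P0 P1.
have pS : p'.+2 = 48 + 2 * p.+1 by rewrite pE mulnS addnCA.
have small a : base + r a < 2 ^ w'.
  by apply: leq_trans le_base; rewrite ltn_add2l; have [] := rr a.
have updr f a v : (forall x, f (15 + x) = r' (15 + x)) -> v < 2 ^ w ->
    forall x, upd f (15 + a) v (15 + x) = upd r a v x /\ upd r a v x < 2 ^ w.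
  move=> fE vw x; rewrite /upd eqn_add2l fE.
  by case: eqP => // _; exact: rr.
have upd2 a u v : upd (upd r' (15 + a) u) (15 + a) v = upd r' (15 + a) v.
  by apply: funext => x; rewrite /upd; case: eqP.
have updE f a v : upd f a v a = v by rewrite /upd eqxx.
have w_gt0 : 0 < 2 ^ w by rewrite expn_gt0.
rewrite (run_step _ _ _ _ Pi); cbn [regs Defs.mem] in r5, r8, rr, mm.
case: i Pi P0 P1 => [a k|o a x y|a x|a x|o a x l|d] Pi P0 P1;
  rewrite [step _ _ _]/=.
- rewrite (run_next _ P0 erefl) (run_next _ P1 erefl) updE.
  rewrite [upd r' _ _ 5]/upd /= r5 upd2; apply: IH; split=> //=.
  have -> : sem_binop w' Mod (k %% 2 ^ w') (2 ^ w) = k %% 2 ^ w.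
    rewrite /sem_binop [LHS]modn_small ?modn_dvdm//.
    by rewrite (leq_trans _ (ltnW lt2))// ltn_mod.
  by apply: updr; rewrite ?ltn_mod.
- rewrite (run_next _ P0 erefl) (run_next _ P1 erefl) updE.
  rewrite [upd r' _ _ 5]/upd /= r5 upd2; apply: IH; split=> //=.
  have [-> _] := rr x; have [-> yw] := rr y.
  by rewrite sem_binop_mod//; apply: updr; rewrite ?ltn_mod.
- rewrite (run_next _ P0 erefl) (run_next _ P1 erefl) updE r8.
  have [-> xw] := rr x; have [mE mw] := mm _ xw.
  rewrite {2}/sem_binop modn_small// mE.
  by apply: IH; split=> //=; apply: updr.
- rewrite (run_next _ P0 erefl) (run_next _ P1 erefl) updE r8.
  have [-> aw] := rr a.
  rewrite {2}/sem_binop modn_small// [upd r' 12 _ _]/upd /=.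
  apply: IH; split=> //= e ew; rewrite /upd eqn_add2l.
  have [-> xw] := rr x; case: eqP => // _; exact: mm.
- rewrite (run_next _ P0 erefl); have [-> _] := rr a; have [-> _] := rr x.
  case: ifP => _ run_s.
    (* A taken branch jumps over the padding and leaves one step unspent. *)
    by apply: (run_mono _ (leqnSn _)); apply: IH run_s; split.
  rewrite (run_next _ P1 erefl).
  by apply: IH run_s; split.
- by case=> <-; rewrite (run_step _ _ _ _ P0).
Qed.

(** * From graphs to Cayley tables *)

Lemma nth_allpairs (S T U : Type) (f : S -> T -> U) x0 y0 z0 s t i j :
  i < size s -> j < size t ->
  nth z0 [seq f x y | x <- s, y <- t] (i * size t + j)
    = f (nth x0 s i) (nth y0 t j).
Proof.
elim: s i => // x s IH [|i] lti ltj /=; rewrite nth_cat size_map.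
  by rewrite add0n ltj (nth_map y0).
by rewrite mulSn -addnA ltnNge leq_addr /= addKn IH.
Qed.

Lemma nth_allpairs_ord (n : nat) (T : Type) (f : 'I_n -> 'I_n -> T) z
    (i j : 'I_n) :
  nth z [seq f x y | x <- enum 'I_n, y <- enum 'I_n] (i * n + j) = f i j.
Proof.
have := @nth_allpairs _ _ _ f i i z (enum 'I_n) (enum 'I_n) i j.
by rewrite size_enum_ord !nth_ord_enum => ->.
Qed.

(* The codes of a zero triangle add up to [3 * n.+1], and the first two are    *)
(* shifted by [2 * n.+1], hence the test against [5 * n.+1]. If it succeeds,  *)
(* the result [7 * n.+1] is nonzero modulo [6 * n.+1].                        *)
Definition sum_code (n x y : nat) : nat :=
  if [|| x == 0, y == 0 | (2 * n.+1 <= x) && (x + y != 5 * n.+1)] then 0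
  else x + y + 2 * n.+1.

(* For [nv G = 0], where [x %% 0 = x], this reads past the end and gives 0.   *)
Definition edge_code (G : wgraph) (x y : nat) : nat :=
  nth 0 (encode_wgraph G) (x %% nv G * nv G + y %% nv G).+1.

Definition cayley_of (G : wgraph) : cayley :=
  let N_gt0 := isT : 0 < 6 * (nv G).+1 in
  @Cayley (6 * (nv G).+1) (Ordinal N_gt0)
    (fun x y => Ordinal (ltn_pmod (sum_code (nv G) x y) N_gt0))
    (fun x y => Ordinal (ltn_pmod (edge_code G x y) N_gt0)).

Lemma edge_codeE (G : wgraph) (x y : nat) (i j : 'I_(nv G)) :
    x %% nv G = i -> y %% nv G = j ->
  edge_code G x y = if adj i j then `|(wt i j + (nv G)%:Z)%R|%N.+1 else 0.
Proof. by rewrite /edge_code /= => -> ->; rewrite nth_allpairs_ord. Qed.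

Lemma edge_code0 (G : wgraph) (x y : nat) : nv G = 0 -> edge_code G x y = 0.
Proof.
move=> G0; rewrite /edge_code /= nth_default // size_allpairs size_enum_ord.
by rewrite G0.
Qed.

Lemma cayley_ofP (G : wgraph) :
  cayley_identity (cayley_of G) <-> ~ has_zero_triangle G.
Proof.
have wb (i j : 'I_(nv G)) : adj i j ->
    ((`|(wt i j + (nv G)%:Z)%R|%N.+1)%:Z = wt i j + (nv G)%:Z + 1)%R
    /\ (`|(wt i j + (nv G)%:Z)%R|%N.+1 <= 2 * nv G + 1)%N.
  move=> /wt_bound; move: (wt i j) (nv G) => a n; split; lia.
split.
  move=> id_G [i [j [k [ij ik jk w0]]]].
  have ltG (u : 'I_(nv G)) : u < 6 * (nv G).+1 by have := ltn_ord u; lia.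
  have /(congr1 val) :=
    id_G (Ordinal (ltG i)) (Ordinal (ltG j)) (Ordinal (ltG k)).
  have sm (u : 'I_(nv G)) : u %% nv G = u by rewrite modn_small.
  rewrite /= (@edge_codeE G i j i j) ?sm// ij.
  rewrite (@edge_codeE G i k i k) ?sm// ik.
  rewrite (@edge_codeE G j k j k) ?sm// jk.
  have [eij lij] := wb _ _ ij; have [eik lik] := wb _ _ ik.
  have [ejk ljk] := wb _ _ jk.
  set x := _.+1 in eij lij *; set y := _.+1 in eik lik *.
  set z := _.+1 in ejk ljk *.
  (* Each code is its weight plus [n + 1], and the weights cancel. *)
  have xyz : x + y + z = 3 * (nv G).+1 by lia.
  have [x0 y0 z0] : [/\ 0 < x, 0 < y & 0 < z] by [].
  clearbody x y z.
  have xyE : sum_code (nv G) x y = x + y + 2 * (nv G).+1.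
    by rewrite /sum_code; case: ifP => //; lia.
  rewrite !(@modn_small x, @modn_small y, @modn_small z) ?xyE; try lia.
  (* The first sum is at most [6n + 4], so it does not wrap around modulo [6 * n.+1]. *)
  rewrite (@modn_small (x + y + _)); last by lia.
  have -> : sum_code (nv G) (x + y + 2 * (nv G).+1) z
          = 6 * (nv G).+1 + (nv G).+1.
    by rewrite /sum_code; case: ifP => //; lia.
  by rewrite modnDl modn_small //; lia.
move=> no_tri x y z; apply: ord_inj => /=.
have [G0|G0] := posnP (nv G).
  by rewrite /cayley_of /= !edge_code0// /sum_code G0.
pose v (t : nat) : 'I_(nv G) := Ordinal (ltn_pmod t G0).
have vE s t := @edge_codeE G s t (v s) (v t) erefl erefl.
rewrite !vE {vE}.
set i := v x; set j := v y; set k := v z.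
(* A missing edge makes a product 0, which absorbs the sums; otherwise the second sum fails its
   test. *)
have := @no_tri; rewrite /has_zero_triangle.
case: (boolP (adj i j)) => ij; last by rewrite /sum_code !mod0n.
case: (boolP (adj i k)) => ik; last first.
  by rewrite /sum_code !mod0n orbT !mod0n.
case: (boolP (adj j k)) => jk; last first.
  by rewrite [X in X %% _]/sum_code !mod0n orbT mod0n.
have [eij lij] := wb _ _ ij; have [eik lik] := wb _ _ ik.
have [ejk ljk] := wb _ _ jk => no.
have {no} w0 : (wt i j + wt i k + wt j k)%R <> 0%R.
  by move=> w0; apply: no; exists i, j, k.
set a := _.+1 in eij lij *; set b := _.+1 in eik lik *.
set c := _.+1 in ejk ljk *.
have abc : a + b + c <> 3 * (nv G).+1 by lia.
have [a0 b0 c0] : [/\ 0 < a, 0 < b & 0 < c] by [].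
clearbody a b c.
have abE : sum_code (nv G) a b = a + b + 2 * (nv G).+1.
  by rewrite /sum_code; case: ifP => //; lia.
rewrite !(@modn_small a, @modn_small b, @modn_small c) ?abE; try lia.
rewrite (@modn_small (a + b + _)); last by lia.
by rewrite /sum_code; case: ifP => //; lia.
Qed.

Lemma edge_code_leq (G : wgraph) (x y : nat) :
  edge_code G x y <= 2 * nv G + 1.
Proof.
have [G0|G0] := posnP (nv G); first by rewrite edge_code0.
pose v t : 'I_(nv G) := Ordinal (ltn_pmod t G0).
rewrite (@edge_codeE G x y (v x) (v y))//; case: ifP => // /wt_bound.
by move: (wt _ _) (nv G) => a n; lia.
Qed.

Lemma nth_encode_cayley_of (G : wgraph) (k : nat) :
  let N := 6 * (nv G).+1 in k < N * N ->
  nth 0 (encode_cayley (cayley_of G)) (2 + k)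
    = sum_code (nv G) (k %/ N) (k %% N) %% N /\
  nth 0 (encode_cayley (cayley_of G)) (2 + N * N + k)
    = edge_code G (k %/ N) (k %% N) %% N.
Proof.
move=> N ltk.
have ltx : k %/ N < N by rewrite ltn_divLR.
have lty : k %% N < N by rewrite ltn_mod.
have sz f : size (@table N f) = N * N by rewrite size_allpairs size_enum_ord.
have kE f : nth 0 (@table N f) k = f (Ordinal ltx) (Ordinal lty).
  have := @nth_allpairs_ord N _ (fun i j => val (f i j)) 0
    (Ordinal ltx) (Ordinal lty).
  by rewrite /= -divn_eq.
split; rewrite /encode_cayley.
  by rewrite add2n /= nth_cat sz ltk kE.
by rewrite -addnA add2n /= nth_cat sz ltnNge leq_addr addKn /= kE.
Qed.

(** * Correctness and cost of writing the tables *)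

Section Setup.
Context (G : wgraph) (c w : nat) (P : program).
Context (n N NN M l : nat).
Context (nE : n = nv G) (NE : N = 6 * n.+1) (NNE : NN = N * N).
Context (lE : l = (trunc_log 2 N).+1) (ME : M = 2 ^ (c * l)).
Context (big : 4 * NN + M <= 2 ^ w).

Let Pr := reduction_program c P.
Let input a := nth 0 (encode_wgraph G) a %% 2 ^ w.
Let output a := nth 0 (encode_cayley (cayley_of G)) a %% M.

Let N6 : 6 * N <= NN. Proof. by rewrite NNE leq_mul2r; lia. Qed.

Ltac arith v := apply: (@reaches_arith _ _ v); [reflexivity
  | rewrite /sem_binop ?[nth _ _ _]/= modn_small //; try lia
  | rewrite [set_nth _ _ _ _]/=].

Ltac branch := apply: reaches_branch; [reflexivity | cbn [nth sem_cmp]].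
Ltac const := apply: reaches_const;
  [reflexivity | lia | rewrite [set_nth _ _ _ _]/=].

Let env1 j :=
  [:: 0; 1; n; N; n.+1; 0; 2 * n.+1; 5 * n.+1; NN; 0; 2 ^ j; j; 5; 0; 0].

Let env2 k x y v u z :=
  [:: 0; 1; n; N; n.+1; M; 2 * n.+1; 5 * n.+1; NN; k; x; y; v; u; z].

(** Doubling from 1 until [N] is exceeded takes exactly the bit length of [N], at four instructions
    per round. *)
Lemma log_loop j t m Q : j <= l ->
    reaches w Pr t (State 15 (nth 0 (env1 l)) m) Q ->
  reaches w Pr (4 * (l - j) + t.+1) (State 11 (nth 0 (env1 j)) m) Q.
Proof.
have [d] := ubnP (l - j); elim: d j => // d IH j.
rewrite ltnS => lt_d le_j end_l.
move: (le_j); rewrite leq_eqVlt => /predU1P[jl|lt_j].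
  have lt_N : N < 2 ^ l by rewrite lE trunc_log_ltn.
  rewrite jl subnn; apply: reaches_branch; first by reflexivity.
  by rewrite /= lt_N.
have N_ge : 2 ^ j <= N.
  apply: (@leq_trans (2 ^ trunc_log 2 N)); first by rewrite leq_exp2l//; lia.
  by apply: trunc_logP => //; lia.
have -> : 4 * (l - j) + t.+1 = (4 * (l - j.+1) + t.+1).+4 by lia.
apply: reaches_branch; first by reflexivity.
rewrite /= ltnNge N_ge /=.
have powS : 2 ^ j + 2 ^ j = 2 ^ j.+1 by rewrite expnS mul2n addnn.
have lt_j2 : j < 2 ^ j by rewrite ltn_expl.
move: powS lt_j2 N_ge IH; set p := 2 ^ j.
rewrite /env1 -/p.
move=> powS lt_j2 N_ge IH.
arith (p + p).
arith (j + 1).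
rewrite powS addn1.
apply: reaches_branch; first by reflexivity.
by apply: IH => //; lia.
Qed.

Lemma init_loop t Q :
    (forall a b v u z, reaches w Pr t (State 20 (nth 0 (env2 0 a b v u z))
       (upd input NN (N %% M))) Q) ->
  reaches w Pr (17 + 4 * l + t) (init_state w (encode_wgraph G)) Q.
Proof.
move=> end_init.
rewrite /init_state -/input.
have -> : (fun=> 0) = nth 0 (nseq 15 0) :> (nat -> nat).
  by apply: funext => i; rewrite nth_nseq if_same.
rewrite [nseq _ _]/= -addnA.
apply: (@reaches_read _ _ n); first by reflexivity.
  rewrite /= /input /= modn_small -?nE//; lia.
rewrite [set_nth _ _ _ _]/=.
const.
arith (n.+1).
const.
arith N.
const.
arith (2 * n.+1).
const.
arith (5 * n.+1).
arith NN.
const.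
have -> : (4 * l + t).+4.+2 = 4 * (l - 0) + t.+4.+2 by lia.
apply: log_loop => //.
(* Both [c] and the simulated word length are below [M], hence fit in a word. *)
have c_lt : c <= c * l by rewrite lE leq_pmulr.
have w_lt : c * l < M by rewrite ME ltn_expl.
const.
arith (c * l).
arith M.
arith (N %% M).
apply: reaches_write; [reflexivity | exact: end_init].
Qed.

(** Ten steps cover the longest path; [u'] is arbitrary because the paths leave different values in
    register 13. *)
Lemma sum_block k a b v u z t m Q : k < NN ->
    (forall u', reaches w Pr t (State 30 (nth 0
      (env2 k (k %/ N) (k %% N) (sum_code n (k %/ N) (k %% N)) u' z)) m) Q) ->
  reaches w Pr (10 + t) (State 20 (nth 0 (env2 k a b v u z)) m) Q.
Proof.
move=> lt_k done_block; rewrite /env2.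
have x_lt : k %/ N < N by rewrite ltn_divLR -?NNE; lia.
have y_lt : k %% N < N by rewrite ltn_mod; lia.
arith (k %/ N).
arith (k %% N).
move: (k %/ N) (k %% N) x_lt y_lt done_block => x y x_lt y_lt done_block.
const.
branch; case: eqP => [x0|/eqP x0].
  by move: (done_block u); rewrite /sum_code x0 eqxx; apply: reaches_leq; lia.
branch; case: eqP => [y0|/eqP y0].
  by move: (done_block u); rewrite /sum_code y0 orbT; apply: reaches_leq; lia.
arith (x + y).
branch; case: ltnP => [lt_x|le_x].
  arith (x + y + 2 * n.+1).
  by move: (done_block (x + y)); rewrite /sum_code ifF;
    [apply: reaches_leq; lia | lia].
branch; case: eqP => [xy|/eqP xy].
  arith (x + y + 2 * n.+1).
  by move: (done_block (x + y)); rewrite /sum_code ifF;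
    [apply: reaches_leq; lia | lia].
branch; rewrite /=.
by move: (done_block (x + y)); rewrite /sum_code ifT;
    [apply: reaches_leq; lia | lia].
Qed.

Lemma store_block k x y s u z t m Q :
    k < NN -> x < N -> y < N -> (forall a, a < NN -> m a = input a) ->
    (forall x' y' v' u' z', reaches w Pr t (State (if k.+1 < NN then 20 else 48)
      (nth 0 (env2 k.+1 x' y' v' u' z'))
      (upd (upd m (NN + (2 + k)) (s %% N %% M)) (NN + (2 + k) + NN)
           (edge_code G x y %% N %% M))) Q) ->
  reaches w Pr (18 + t) (State 30 (nth 0 (env2 k x y s u z)) m) Q.
Proof.
move=> lt_k lt_x lt_y mE done_block; rewrite /env2.
have M_gt0 : 0 < M by rewrite ME expn_gt0.
have N_gt0 : 0 < N by rewrite NE.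
have ltN e : e %% N < N by rewrite ltn_mod.
have ltM e : e %% M < M by rewrite ltn_mod.
arith (s %% N).
arith (s %% N %% M).
const.
arith (2 + k).
arith (NN + (2 + k)).
apply: reaches_write; [reflexivity | cbn [nth]].
(* The writes start at address [NN], so the input cell read here is intact. For [n = 0] the
   remainder [y %% n] is [y], still below [N]. *)
have lt_addr : x %% n * n + y %% n + 1 < NN.
  have [n0|n_gt0] := posnP n; first by rewrite n0 muln0 modn0; lia.
  have := ltn_pmod x n_gt0; have := ltn_pmod y n_gt0.
  by rewrite NNE NE; nia.
arith (x %% n).
arith (x %% n * n).
arith (y %% n).
arith (x %% n * n + y %% n).
arith (x %% n * n + y %% n + 1).
apply: (@reaches_read _ _ (edge_code G x y)); first by reflexivity.
  cbn [nth]; rewrite /upd ltn_eqF ?mE//; last by lia.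
  have := edge_code_leq G x y; rewrite /input /edge_code !addn1 -nE => le_e.
  by rewrite [LHS]modn_small//; lia.
rewrite [set_nth _ _ _ _]/=.
arith (edge_code G x y %% N).
arith (edge_code G x y %% N %% M).
arith (NN + (2 + k) + NN).
apply: reaches_write; [reflexivity | cbn [nth]].
arith (k + 1).
rewrite addn1; branch.
exact: done_block.
Qed.

(** The zeros elsewhere matter: the simulated machine expects cleared memory after its input. *)
Let written k m := (forall a, a < NN -> m a = input a) /\
  forall a, m (NN + a) =
    if (a < 2 + k) || (2 + NN <= a < 2 + NN + k) then output a else 0.

Lemma writtenS k m : k < NN -> written k m ->
  written k.+1 (upd (upd m (NN + (2 + k))
      (sum_code n (k %/ N) (k %% N) %% N %% M)) (NN + (2 + k) + NN)
      (edge_code G (k %/ N) (k %% N) %% N %% M)).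
Proof.
move=> lt_k [m_in m_out]; have lt_k' := lt_k.
move: lt_k'; rewrite NNE NE nE => /nth_encode_cayley_of[].
rewrite -nE -NE -NNE => plusE dotE.
split=> a; first by move=> lt_a; rewrite /upd !ltn_eqF ?m_in//; lia.
rewrite /upd -addnA !eqn_add2l m_out.
case: eqP => [->|a1].
  by rewrite ifT /output -?dotE; [congr (nth _ _ _ %% _)|]; lia.
case: eqP => [->|a2]; first by rewrite ifT /output -?plusE//; lia.
by congr (if _ then _ else _); lia.
Qed.

Lemma fill_loop k a b v u z t m Q : k < NN -> written k m ->
    (forall a b v u z m', written NN m' ->
      reaches w Pr t (State 48 (nth 0 (env2 NN a b v u z)) m') Q) ->
  reaches w Pr (28 * (NN - k) + t) (State 20 (nth 0 (env2 k a b v u z)) m) Q.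
Proof.
move=> + + end_loop.
have [d] := ubnP (NN - k); elim: d k a b v u z m => // d IH k a b v u z m.
rewrite ltnS => lt_d lt_k wr_m.
have -> : 28 * (NN - k) + t = 10 + (18 + (28 * (NN - k.+1) + t)) by lia.
apply: sum_block => // u'.
have x_lt : k %/ N < N by rewrite ltn_divLR -?NNE; lia.
have y_lt : k %% N < N by rewrite ltn_mod; lia.
apply: store_block => //; first by case: wr_m.
move=> x' y' v' u1 z'; have wr_m' := writtenS lt_k wr_m.
case: ltnP => [lt_k1|le_k1]; first by apply: IH => //; lia.
have kE : k.+1 = NN by lia.
by rewrite kE subnn in wr_m' *; exact: end_loop.
Qed.

Lemma setup_correct :
  reaches w Pr (40 * NN) (init_state w (encode_wgraph G))
    (simulates (c * l) NN (init_state (c * l) (encode_cayley (cayley_of G)))).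
Proof.
have le_lN : l <= N.
  rewrite lE; apply: leq_trans (trunc_logP (isT : 1 < 2) _); last by lia.
  by rewrite ltn_expl.
apply: (@reaches_leq _ _ (17 + 4 * l + (28 * (NN - 0) + 0))); first by lia.
have sz_in : size (encode_wgraph G) <= NN.
  by rewrite /= size_allpairs size_enum_ord -nE NNE NE; nia.
apply: init_loop => a b v u z; apply: fill_loop; first by lia.
  (* Before the loop only the two header cells count: the cardinality was just written, and the
     designated element 0 is already there, as the graph's encoding ends before [NN]. *)
  split=> e; first by move=> lt_e; rewrite /upd ltn_eqF.
  rewrite /upd -{2}(addn0 NN) eqn_add2l /input /output.
  case: e => [|[|e]] /=; first by rewrite NE nE.
    by rewrite nth_default ?mod0n//; lia.
  by rewrite nth_default ?mod0n ?ifF//; lia.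
move=> a' b' v' u' z' m' [_ m_out]; apply: reaches_now.
split=> //.
- by move=> r; rewrite [regs _ _]/= nth_default// expn_gt0.
- move=> e lt_e; rewrite /= m_out /output ME.
  split; last by rewrite ltn_mod expn_gt0.
  case: ifP => // e_big; rewrite nth_default ?mod0n//.
  by rewrite /= size_cat !size_allpairs size_enum_ord -nE -NE -NNE; lia.
Qed.

End Setup.

(** * Word length and running time of the reduction *)

Lemma word_length_reduction c n :
  4 * (6 * n.+1 * (6 * n.+1)) + 2 ^ word_length c (6 * n.+1)
    <= 2 ^ word_length (4 * c + 11) n.
Proof.
set N := 6 * n.+1; rewrite /word_length; set L := trunc_log 2 n.
have lt_n : n < 2 ^ L.+1 by exact: trunc_log_ltn.
have le_N : trunc_log 2 N < L.+4.
  rewrite -(@ltn_exp2l 2)// (leq_ltn_trans (trunc_logP _ _))//.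
  by rewrite (expnD 2 3 L.+1); lia.
(* The bit length of [N] is at most [L + 4], hence at most [4 * L.+1]. *)
have le_w : c * (trunc_log 2 N).+1 <= (4 * c + 10) * L.+1 by nia.
have le_NN : 4 * (N * N) <= 2 ^ ((4 * c + 10) * L.+1).
  apply: (@leq_trans (2 ^ (8 + L.+1 + L.+1))); last by rewrite leq_exp2l//; nia.
  by rewrite !expnD /N; nia.
have : 2 ^ (c * (trunc_log 2 N).+1) <= 2 ^ ((4 * c + 10) * L.+1).
  by rewrite leq_exp2l.
(* The eleventh multiple of [L.+1] provides the bit needed to add the two bounds. *)
have : 2 ^ ((4 * c + 10) * L.+1).+1 <= 2 ^ ((4 * c + 11) * L.+1).
  by rewrite leq_exp2l//; lia.
by rewrite expnS; lia.
Qed.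

Lemma reduction_decides P c T : decides P c T identity_checking ->
  decides (reduction_program c P) (4 * c + 11)
    (fun n => let N := 6 * n.+1 in 40 * (N * N) + 2 * T N) zero_triangle.
Proof.
move=> dec G; have [b [run_b bP]] := dec (cayley_of G).
exists (~~ b); split; last first.
  move: bP; rewrite [yes _]/= cayley_ofP; case: b {run_b} => bP /=.
    by split=> // /(bP.1 isT).
  by split=> // _; apply: contrapT => /bP.
have big := word_length_reduction c (nv G).
have [t [s [le_t sim run_s]]] :=
  setup_correct P erefl erefl erefl erefl erefl big.
move: run_b; rewrite [size_of _]/= [encode _]/= => run_b.
have lt_w : word_length c (6 * (nv G).+1) < word_length (4 * c + 11) (nv G).
  by rewrite -(@ltn_exp2l 2)//; apply: leq_trans big; lia.
have := simulation c lt_w _ sim run_b; rewrite -run_s => run_b'.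
by apply: run_mono (run_b' _) _; [apply: leq_trans big; lia|rewrite leq_add].
Qed.

Section RunningTime.
Import Order.TTheory GRing.Theory Num.Theory.
Local Open Scope classical_set_scope.
Local Open Scope ring_scope.

Lemma time_reduction (R : realType) (T : nat -> nat) (eps : R) : 0 < eps ->
    ((fun n => (T n)%:R : R) =O_\oo (fun n => n%:R `^ (3 - eps))) ->
  ((fun n => (let N := 6 * n.+1 in 40 * (N * N) + 2 * T N)%N%:R : R)
    =O_\oo (fun n => n%:R `^ (3 - Num.min eps 1))).
Proof.
move=> eps_gt0 /eqO_exP[C C_gt0 [n0 _ leT]]; apply/eqO_exP.
set e := 3 - Num.min eps 1.
have e_ge2 : 2 <= e.
  have : Num.min eps 1 <= 1 by rewrite ge_min lexx orbT.
  by rewrite /e; lra.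
exists (40 * 12 ^+ 2 + 2 * (C * 12 `^ e)).
  by rewrite ltr_wpDr ?mulr_ge0 ?powR_ge0 ?ltW.
(* From [n >= 1] on, [6 * n.+1 <= 12 * n], which is the source of the 12 in the constant. *)
exists (maxn n0 1) => // n /=; rewrite geq_max => /andP[le_n0 n_gt0].
set N := (6 * n.+1)%N.
have le_N : N%:R <= 12 * n%:R :> R by rewrite -natrM ler_nat /N; lia.
have N_ge1 : 1 <= N%:R :> R by rewrite -[1]/(1%:R) ler_nat.
have n_ge1 : 1 <= n%:R :> R by rewrite -[1]/(1%:R) ler_nat.
have TN : (T N)%:R <= C * (12 `^ e * n%:R `^ e).
  have le0N : (n0 <= N)%N by rewrite /N; lia.
  have := leT _ le0N; rewrite /= !ger0_norm ?powR_ge0// => /le_trans; apply.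
  rewrite ler_pM2l// -powRM//.
  apply: (@le_trans _ _ (N%:R `^ e)).
    by apply: ler_powR => //; rewrite /e lerB// ge_min lexx.
  by apply: ge0_ler_powR; rewrite ?nnegrE//; lra.
have n2 : n%:R ^+ 2 <= n%:R `^ e by rewrite -powR_mulrn// ler_powR.
have N2 : N%:R ^+ 2 <= 12 ^+ 2 * n%:R ^+ 2 :> R.
  by rewrite -exprMn lerXn2r ?nnegrE//; lra.
clearbody N; rewrite !ger0_norm ?powR_ge0// natrD !natrM -expr2.
move: (n%:R `^ e) (12 `^ e) (n%:R ^+ 2) (N%:R ^+ 2) (T N)%:R n2 N2 TN.
by move=> ne ce n2 N2 TN; lra.
Qed.

End RunningTime.

Theorem theorem1p2 (R : realType) :
  (exists eps : R, (0 < eps)%R /\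
     solvable_in_time identity_checking (fun n => n%:R `^ (3 - eps))%R) ->
  ~ strong_zero_triangle_hypothesis R.
Proof.
move=> [eps [eps_gt0 [P [c [T [dec T_O]]]]]] /(_ (Num.min eps 1%R)).
apply.
  by rewrite Order.TotalTheory.lt_min eps_gt0 Num.Theory.ltr01.
exists (reduction_program c P), (4 * c + 11)%N; eexists; split.
  exact: reduction_decides dec.
exact: time_reduction.
Qed.
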